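(* Let $V$ be a generalized conformal module of corank one over the Virasoro conformal algebra $Vir$. Then $V\cong U_{a,b}$ for some $a,b\in\mathbb{C}$. Moreover, $U_{a,b}$ is irreducible if and only if $(a,b)\neq(0,0)$.
   Context: The Virasoro conformal algebra is $Vir=\mathbb{C}[\partial]L$ with $[L_\lambda L]=(\partial+2\lambda)L$. A generalized conformal module $V$ over $Vir$ is a $\mathbb{C}[\partial]$-module with a linear map $L_\lambda:V\to V[[\lambda]]$ such that $L_\lambda(\partial v)=(\partial+\lambda)L_\lambda v$ and $L_\lambda(L_\mu v)-L_\mu(L_\lambda v)=(\lambda-\mu)L_{\lambda+\mu}v$ in $V[[\lambda,\mu]]$ for all $v\in V$ ($L_\lambda$ extended coefficientwise to power series). A submodule is a $\mathbb{C}[\partial]$-submodule $W$ with $L_\lambda W\subseteq W[[\lambda]]$; $V$ is irreducible if $V\ne0$ and its only submodules are $0$ and $V$. An isomorphism (denoted $\cong$) is a bijective $\mathbb{C}[\partial]$-linear map commuting with $L_\lambda$. $V$ is of corank one if its underlying $\mathbb{C}[\partial]$-module has a $\mathbb{C}$-basis $v_0,v_1,v_2,\ldots$ with $\partial v_i=v_{i-1}$ for $i\ge0$, where $v_{-1}=0$ (equivalently, it is isomorphic to $\mathbb{C}[t]$ with $\partial=\frac{d}{dt}$). For $a,b\in\mathbb{C}$, $U_{a,b}=\mathbb{C}[t]$ with $\partial=\frac{d}{dt}$ and $L_\lambda f(t)=e^{-\lambda t}(\partial-a\lambda+b)f(t)=e^{-\lambda t}\big(f'(t)-a\lambda f(t)+bf(t)\big)$;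 this is a generalized conformal module over $Vir$.
   Formalization: The classification assumes that L_λ is not identically zero on V; without this the claim is false, since C[t] with ∂ = d/dt and L_λ = 0 has corank one but is not isomorphic to any U_{a,b} (there L_0 t = 1 + bt ≠ 0). *)

(* Defs.v *)
From HB Require Import structures.
From mathcomp Require Import all_boot all_order all_algebra.
From mathcomp Require Import complex.
From mathcomp Require Import boolp classical_sets functions reals.
From mathcomp Require Import ring.

Set Implicit Arguments.
Unset Strict Implicit.
Unset Printing Implicit Defensive.

Import Order.TTheory GRing.Theory Num.Theory.
Local Open Scope ring_scope.

(* A formal power series in V[[lambda]] is its sequence of coefficients, with
   the pointwise module structure of [nat -> V].  A series in
   V[[lambda, mu]] has type [fps (fps V)]: the coefficient of
   lambda^m mu^n in F is [F m n]. *)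
Notation fps V := (nat -> V).

Section PowerSeries.
Variable V : zmodType.

(* multiplication by the variable *)
Definition mulvar (A : fps V) : fps V :=
  fun n => if n is m.+1 then A m else 0.

Definition fpsC (v : V) : fps V := fun n => if n is 0%N then v else 0.

(* The substitution lambda := lambda + mu. *)
Definition subst_add (A : fps V) : fps (fps V) :=
  fun m n => A (m + n)%N *+ 'C(m + n, m).

(* The products of F by lambda and by mu. *)
Definition mul_lambda (F : fps (fps V)) : fps (fps V) :=
  fun m n => mulvar (fun k => F k n) m.
Definition mul_mu (F : fps (fps V)) : fps (fps V) :=
  fun m n => mulvar (F m) n.

End PowerSeries.

Definition fps_mul (A : pzRingType) (F G : fps A) : fps A :=
  fun n => \sum_(i < n.+1) F i * G (n - i)%N.

(* Generalized conformal modules over Vir.  A K[d]-module is a K-module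
   together with an endomorphism; [gc_act v] is the series L_lambda v. *)
Record gcmod (K : numFieldType) := GCMod {
  gc_sort :> lmodType K;
  gc_der : {linear gc_sort -> gc_sort};
  gc_act : {linear gc_sort -> fps gc_sort};
  gc_act_der : forall v,
    gc_act (gc_der v) = (fun n => gc_der (gc_act v n)) + mulvar (gc_act v);
  gc_jacobi : forall v,
    (fun m n => gc_act (gc_act v n) m) - (fun m n => gc_act (gc_act v m) n) =
    mul_lambda (subst_add (gc_act v)) - mul_mu (subst_add (gc_act v))
      :> fps (fps gc_sort)
}.
Arguments gc_der {K}.
Arguments gc_act {K}.

Section Notions.
Variable K : numFieldType.
Implicit Types V W : gcmod K.

(* The zero action on K[t] with d = d/dt satisfies the axioms and has corank
   one, but the action of no U_{a,b} is zero. *)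
Definition gc_nontrivial V : Prop := exists v : V, gc_act V v <> 0.

Definition gc_submodule V (S : set V) : Prop :=
  [/\ S 0,
      forall x y, S x -> S y -> S (x + y),
      forall (c : K) x, S x -> S (c *: x),
      forall x, S x -> S (gc_der V x)
    & forall x n, S x -> S (gc_act V x n)].

Definition gc_irreducible V : Prop :=
  (exists v : V, v <> 0) /\
  forall S : set V, gc_submodule S -> S = [set 0]%classic \/ S = setT.

Definition gc_isom V W : Prop :=
  exists phi : {linear V -> W},
    [/\ bijective phi,
        forall v, phi (gc_der V v) = gc_der W (phi v)
      & forall v n, phi (gc_act V v n) = gc_act W (phi v) n].

Definition is_basis (V : lmodType K) (v : nat -> V) : Prop :=
  (forall x, exists n (c : nat -> K), x = \sum_(i < n) c i *: v i) /\
  (forall n (c : nat -> K), \sum_(i < n) c i *: v i = 0 ->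
     forall i, (i < n)%N -> c i = 0).

Definition corank_one V : Prop :=
  exists v : nat -> V, is_basis v /\
    forall i, gc_der V (v i) = if i is j.+1 then v j else 0.

End Notions.

Section Uab.
Variables (K : numFieldType) (a b : K).
Implicit Types f g : {poly K}.

(* exp(- lambda t) as a power series in lambda with coefficients in K[t] *)
Definition expNt : fps {poly K} :=
  fun n => ((-1) ^+ n / n`!%:R) *: 'X^n.

Definition U_act f : fps {poly K} :=
  fps_mul expNt (fpsC (f^`()) - a *: mulvar (fpsC f) + b *: fpsC f).

Let eN := mulvar expNt.
Let D f := f^`() + b *: f.

Lemma U_actE f n : U_act f n = expNt n * D f - a *: (eN n * f).
Proof.
rewrite /U_act /fps_mul big_ord_recr /= subnn.
have H j : (fpsC f^`() - a *: mulvar (fpsC f) + b *: fpsC f) j =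
  fpsC f^`() j - a *: mulvar (fpsC f) j + b *: fpsC f j by [].
rewrite H /= scaler0 subr0 [RHS]addrC; congr (_ + _).
case: n => [|n]; first by rewrite big_ord0 /eN /= mul0r scaler0 oppr0.
rewrite big_ord_recr big1 /= => [|i _].
  by rewrite add0r H subSnn /= scaler0 addr0 sub0r mulrN scalerAr.
rewrite H; have -> : (n.+1 - i = (n - i).-1.+2)%N.
  by rewrite subSn ?prednK ?subn_gt0 // ltnW.
by rewrite /= !scaler0 subr0 addr0 mulr0.
Qed.

Fact U_act_linear : linear U_act.
Proof.
move=> c f g; apply/funext => n.
have -> : (c *: U_act f + U_act g) n = c *: U_act f n + U_act g n by [].
rewrite !U_actE /D derivD derivZ -!mul_polyC; ring.
Qed.
HB.instance Definition _ :=
  GRing.isLinear.Build K {poly K} (fps {poly K}) _ U_act U_act_linear.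

Let expNtM i j : expNt i * expNt j = expNt (i + j)%N *+ 'C(i + j, i).
Proof.
have F k : k`!%:R != 0 :> K by rewrite pnatr_eq0 -lt0n fact_gt0.
rewrite /expNt -scalerAl -scalerAr scalerA -exprD scalerMnl; congr (_ *: _).
rewrite -mulr_natr exprD -(bin_fact (leq_addr j i)) addKn !natrM.
have B0 : 'C(i + j, i)%:R != 0 :> K by rewrite pnatr_eq0 -lt0n bin_gt0 leq_addr.
by field; rewrite !F B0.
Qed.

Let expNt_deriv n : (expNt n)^`() = - eN n.
Proof.
case: n => [|n]; first by rewrite /expNt /= expr0 linearZ /= derivC scaler0 oppr0.
have F : n`!%:R != 0 :> K by rewrite pnatr_eq0 -lt0n fact_gt0.
have N0 : n.+1%:R != 0 :> K by rewrite pnatr_eq0.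
rewrite /eN /= /expNt derivZ derivXn /= -scaleNr -scaler_nat scalerA.
congr (_ *: _); rewrite factS natrM exprS; field.
by rewrite F addrC natr1 N0.
Qed.

Fact U_act_der f :
  U_act f^`() = (fun n => (U_act f n)^`()) + mulvar (U_act f).
Proof.
apply/funext => n.
have -> : ((fun n => (U_act f n)^`()) + mulvar (U_act f)) n =
  (U_act f n)^`() + mulvar (U_act f) n by [].
rewrite !U_actE /D derivB derivZ !derivM expNt_deriv derivD (derivZ b).
case: n => [|n] /=.
  by rewrite /eN /= deriv0 -!mul_polyC; ring.
by rewrite U_actE expNt_deriv /D /eN /= -!mul_polyC; ring.
Qed.

Fact U_jacobi f :
  (fun m n => U_act (U_act f n) m) - (fun m n => U_act (U_act f m) n) =
  mul_lambda (subst_add (U_act f)) - mul_mu (subst_add (U_act f))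
    :> fps (fps {poly K}).
Proof.
apply/funext => m; apply/funext => n.
set lhs := LHS; have {lhs}-> : lhs = U_act (U_act f n) m - U_act (U_act f m) n by [].
set rhs := RHS; have {rhs}-> : rhs = mul_lambda (subst_add (U_act f)) m n
  - mul_mu (subst_add (U_act f)) m n by [].
have DE k g : D (expNt k * g) = expNt k * D g - eN k * g.
  by rewrite /D derivM expNt_deriv -!mul_polyC; ring.
have DeN k g : D (eN k * g) = eN k * D g - mulvar eN k * g.
  case: k => [|k]; last exact: DE.
  by rewrite /D /eN /= !mul0r subr0 linear0 scaler0 addr0.
have DB g h : D (g - a *: h) = D g - a *: D h.
  by rewrite /D derivB derivZ -!mul_polyC; ring.
rewrite !U_actE !DB !DE !DeN.
have S i j : U_act f (i + j)%N *+ 'C(i + j, i) =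
    expNt i * expNt j * D f
    - a *: ((eN i * expNt j + expNt i * eN j) * f).
  rewrite U_actE mulrnBl -mulrnAl -expNtM; congr (_ - _).
  rewrite scalerMnr -mulrnAl; congr (_ *: (_ * _)).
  case: i j => [|i] [|j] /=; rewrite /eN /= ?mul0r ?mulr0 ?add0r ?addr0 ?mul0rn //.
  - by rewrite expNtM add0n !bin0.
  - by rewrite expNtM addn0 addSn addn0 !binn.
  - by rewrite !expNtM addSn addnS /= binS mulrnDr addrC.
have SE : subst_add (U_act f) = fun i j => expNt i * expNt j * D f
    - a *: ((eN i * expNt j + expNt i * eN j) * f).
  by apply/funext => i; apply/funext => j; rewrite -S.
rewrite SE /mul_lambda /mul_mu.
by case: m n => [|m] [|n] /=; rewrite -!mul_polyC /eN /=; ring.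
Qed.

Definition U : gcmod K :=
  @GCMod K {poly K} (@deriv K : {linear {poly K} -> {poly K}})
    (U_act : {linear {poly K} -> fps {poly K}}) U_act_der U_jacobi.

End Uab.

(* Main.v *)
(* Write L_n for the coefficients of L_lambda; they satisfy
   [L_n, D] = L_(n-1) and the brackets of (rescaled) polynomial vector fields.
   An operator on K[t] commuting with D = d/dt is a series in D, hence onto unless it
   is zero; if it also commutes with L_1 it is a scalar as soon as L_0 <> 0.
   This applies to L_0 - D, so L_0 = D + b, then to the Casimir element
   2 L_2 L_0 - L_1^2 - L_1 and to its cubic analogue containing L_3.  So L_2
   and L_3 are determined by L_0, L_1 and two scalars c, d, and the two ways
   of producing L_6 from L_2 and L_3 put (c, d) on the cubic curve
   d^2 - 6cd + 8c^2 + 4c^3 = 0, whose rational parametrization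
   c = a(1 - a), d = 2a(1 + a)(1 - a) gives the parameter a.
   Finally T = - (L_1 + a) L_0^-1 satisfies [D, T] = 1, and f |-> f(T) 1 is an
   isomorphism from U_(a,b): it intertwines L_0, ..., L_3, and [L_2, L_n] is a
   nonzero multiple of L_(n+1) for n >= 3. *)
From HB Require Import structures.
Require Import Defs.
From mathcomp Require Import all_boot all_order all_algebra.
From mathcomp Require Import complex.
From mathcomp Require Import reals.
From mathcomp Require Import boolp classical_sets functions ring.

Set Implicit Arguments.
Unset Strict Implicit.
Unset Printing Implicit Defensive.

Import Order.TTheory GRing.Theory Num.Theory.
Local Open Scope ring_scope.

(** * Linear combinations with polynomial coefficient families *)

Section LinearCombinations.
Variables (R : nzRingType) (V : lmodType R).
Implicit Types (w : nat -> V) (f : {poly R}).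

(** A polynomial serves as a finitely supported family of scalars, so [lincomb w] is the linear map
    out of R[t] with t^i |-> w_i. *)
Definition lincomb w f : V := \sum_(i < size f) f`_i *: w i.

Lemma lincombE w n f : (size f <= n)%N ->
  lincomb w f = \sum_(i < n) f`_i *: w i.
Proof.
move=> le_f_n; rewrite /lincomb (big_ord_widen n (fun i => f`_i *: w i)) //.
rewrite big_mkcond; apply: eq_bigr => i _.
by case: ltnP => // le_f_i; rewrite nth_default // scale0r.
Qed.

Fact lincomb_is_linear w : linear (lincomb w).
Proof.
move=> c f g; set n := maxn (size f) (size g).
have le_n : (size (c *: f + g)%R <= n)%N.
  rewrite (leq_trans (size_polyD _ _)) // geq_max leq_maxr andbT.
  by rewrite (leq_trans (size_scale_leq _ _)) // leq_maxl.
rewrite !(@lincombE w n) ?leq_maxl ?leq_maxr // scaler_sumr -big_split /=.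
by apply: eq_bigr => i _; rewrite coefD coefZ scalerDl scalerA.
Qed.
HB.instance Definition _ w :=
  GRing.isLinear.Build R {poly R} V _ (lincomb w) (lincomb_is_linear w).

Lemma lincombC w c : lincomb w c%:P = c *: w 0%N.
Proof.
by rewrite (lincombE w (size_polyC_leq1 c)) big_ord1 coefC.
Qed.

Lemma lincombMX w f : lincomb w (f * 'X) = lincomb (w \o succn) f.
Proof.
rewrite (@lincombE w (size f).+1) ?size_polyMX_leq //; last first.
  have [->|f0] := eqVneq f 0; first by rewrite mul0r size_poly0.
  by rewrite size_mulX.
rewrite big_ord_recl coefMX scale0r add0r.
by apply: eq_bigr => i _; rewrite coefMX.
Qed.

Lemma lincombXn w n : lincomb w 'X^n = w n.
Proof.
elim: n w => [|n IHn] w; first by rewrite expr0 lincombC scale1r.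
by rewrite exprSr lincombMX IHn.
Qed.

End LinearCombinations.

(** * Evaluation of a polynomial at an operator *)

Section OperatorEvaluation.
Variables (R : comNzRingType) (V : lmodType R) (T : {linear V -> V}).
Implicit Types (p q : {poly R}) (v : V).

Definition opev v q : V := lincomb (fun i => iter i T v) q.
HB.instance Definition _ v := GRing.isLinear.Build R {poly R} V _ (opev v)
  (lincomb_is_linear (fun i => iter i T v)).

Lemma opevC v c : opev v c%:P = c *: v.
Proof. exact: lincombC. Qed.

Lemma opevMX v q : opev v (q * 'X) = T (opev v q).
Proof.
rewrite /opev lincombMX /lincomb linear_sum /=.
by apply: eq_bigr => i _; rewrite linearZ.
Qed.

Lemma opevX v : opev v 'X = T v.
Proof. by rewrite -['X]mul1r opevMX -polyC1 opevC scale1r. Qed.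

Lemma opevM v p q : opev v (p * q) = opev (opev v q) p.
Proof.
elim/poly_ind: p => [|p c IHp]; first by rewrite mul0r !linear0.
by rewrite mulrDl mulrAC !linearD /= !opevMX IHp mul_polyC linearZ /= opevC.
Qed.

End OperatorEvaluation.

(** * Operators on K[t] commuting with D = d/dt *)

Section Commutant.
Variable K : numFieldType.
Implicit Types (f g : {poly K}) (A : {linear {poly K} -> {poly K}}).

Definition comm_deriv A := forall f, A f^`() = (A f)^`().

Lemma deriv_eq0 f : f^`() = 0 -> f = (f`_0)%:P.
Proof.
move=> f'0; apply/polyP=> -[|i]; rewrite coefC //=.
have /eqP := congr1 (fun g : {poly K} => g`_i) f'0.
by rewrite coef_deriv coef0 mulrn_eq0 => /eqP.
Qed.

Lemma antiderivative f : exists F, F^`() = f.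
Proof.
exists (\poly_(i < (size f).+1) (f`_i.-1 / i%:R)); apply/polyP=> i.
rewrite coef_deriv coef_poly ltnS; case: ltnP => [_|le_f_i].
  by rewrite -[LHS]mulr_natr divfK // pnatr_eq0.
by rewrite mul0rn nth_default.
Qed.

(** The last nonzero iterated derivative of f is a constant. This is applied to images, kernels and
    submodules alike. *)
Lemma deriv_closed_const (P : {poly K} -> Prop) :
    (forall f, P f -> P f^`()) ->
  forall f, P f -> f <> 0 -> exists2 c, c != 0 & P c%:P.
Proof.
move=> P' f; have [n le_n] := ubnP (size f).
elim: n f le_n => // n IHn f le_n Pf /eqP f0.
have [f'0|/eqP f'0] := eqVneq f^`() 0.
  move: f0 Pf; rewrite (deriv_eq0 f'0) polyC_eq0 => c0 Pc; by exists f`_0.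
apply: (IHn f^`()) => //; last exact: P'.
by rewrite (leq_trans (lt_size_deriv f0)).
Qed.

(** The image is closed under D, so it contains a nonzero constant. By induction on the size of g,
    integrating a preimage of g' gives a preimage of g up to a constant, which is then corrected. *)
Lemma comm_deriv_surj A : comm_deriv A -> (exists f, A f <> 0) ->
  forall g, exists f, A f = g.
Proof.
move=> A' [f0 Af0].
have imA' h : (exists f, A f = h) -> exists f, A f = h^`().
  by case=> f <-; exists f^`().
have [c c0 [r Ar]] := deriv_closed_const imA' (ex_intro _ f0 erefl) Af0.
move=> g; have [n le_n] := ubnP (size g).
elim: n g le_n => // n IHn g le_n.
have [->|g0] := eqVneq g 0; first by exists 0; rewrite linear0.
have [f Af] := IHn g^`() (leq_trans (lt_size_deriv g0) le_n).
have [F F'] := antiderivative f.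
have [e eE] : exists e, A F - g = e%:P.
  by exists (A F - g)`_0; apply: deriv_eq0; rewrite derivB -A' F' Af subrr.
exists (F - (e / c) *: r); rewrite linearB linearZ /= Ar.
by rewrite -mul_polyC -polyCM divfK // -eE opprB addrC subrK.
Qed.

(** A nonzero kernel, being closed under D, would contain a nonzero constant and hence 1. *)
Lemma comm_deriv_inj A : comm_deriv A -> A 1 <> 0 -> injective A.
Proof.
move=> A' A1 f g /eqP; rewrite -subr_eq0 -linearB => /eqP Afg.
apply/eqP; rewrite -subr_eq0; apply/eqP; apply: contrapT => fg.
have kerA' h : A h = 0 -> A h^`() = 0 by move=> Ah; rewrite A' Ah deriv0.
have [c c0] := deriv_closed_const kerA' Afg fg.
rewrite -[c%:P]mulr1 mul_polyC linearZ /= => /eqP.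
by rewrite scaler_eq0 (negPf c0) => /eqP.
Qed.

Lemma mulrn_fact_inj n f g : f *+ n`! = g *+ n`! -> f = g.
Proof.
by move/eqP; rewrite -subr_eq0 -mulrnBl -scaler_nat scaler_eq0 pnatr_eq0
  -[_ == 0%N]negbK -lt0n fact_gt0 subr_eq0 => /eqP.
Qed.

Lemma comm_nderivn A n f : comm_deriv A -> A f^`N(n) = (A f)^`N(n).
Proof.
move=> A'; apply: (@mulrn_fact_inj n); rewrite -(linearMn A) -!nderivn_def.
elim: n => [|n IHn]; first by rewrite !derivn0.
by rewrite !derivnS A' IHn.
Qed.

Lemma coef0_nderivn n f : (f^`N(n))`_0 = f`_n.
Proof. by rewrite coef_nderivn addn0 binn. Qed.

(* The Taylor expansion of an operator commuting with d/dt. *)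
Lemma comm_derivE A f n : comm_deriv A -> (size f <= n)%N ->
  A f = \sum_(j < n) (A 'X^j)`_0 *: f^`N(j).
Proof.
move=> A' le_n; apply/polyP => k; rewrite -coef0_nderivn -comm_nderivn //.
have le_kn : (size f^`N(k) <= n)%N.
  apply/leq_sizeP => j le_nj; rewrite coef_nderivn nth_default ?mul0rn //.
  by rewrite (leq_trans le_n) // (leq_trans le_nj) // leq_addl.
rewrite -[X in A X]coefK poly_def linear_sum coef_sum.
rewrite (big_ord_widen n (fun j => (A ((f^`N(k))`_j *: 'X^j))`_0)) //.
rewrite big_mkcond coef_sum /=; apply: eq_bigr => j _.
rewrite coefZ [in RHS]coef_nderivn addnC -(bin_sub (leq_addl k j)) addnK.
rewrite -coef_nderivn; case: ltnP => [_|le_kj].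
  by rewrite linearZ coefZ mulrC.
by rewrite (nth_default _ le_kj) mulr0.
Qed.

(** From [A, D] = B and [B, D] = 0 follows [A, D^(n+1)] = (n+1) D^n B, to be divided by (n+1)!. *)
Lemma nderivn_ladder (A B : {linear {poly K} -> {poly K}}) n f :
    (forall g, A g^`() = (A g)^`() + B g) -> comm_deriv B ->
  A f^`N(n.+1) = (A f)^`N(n.+1) + (B f)^`N(n).
Proof.
move=> A' B'; apply: (@mulrn_fact_inj n.+1).
rewrite mulrnDl -(linearMn A) -!nderivn_def factS mulnC mulrnA -nderivn_def.
elim: n => [|n IHn]; first by rewrite !derivn1 A' derivn0 mulr1n.
rewrite derivnS A' IHn derivD derivMn -!derivnS -addrA; congr (_ + _).
have -> : B f^`(n.+1) = (B f)^`(n.+1).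
  elim: n.+1 => [|m IHm]; first by rewrite !derivn0.
  by rewrite !derivnS B' IHm.
by rewrite -mulrSr.
Qed.

(* Writing A = sum_j a_j d^(j)/j! and taking the commutator with L1 gives
   (sum_j a_(j+1) d^(j)/j!) L0 = 0, and L0 is surjective. *)
Lemma comm_scalar (L0 L1 A : {linear {poly K} -> {poly K}}) :
    comm_deriv L0 -> (exists f, L0 f <> 0) ->
    (forall g, L1 g^`() = (L1 g)^`() + L0 g) ->
    comm_deriv A -> (forall f, A (L1 f) = L1 (A f)) ->
  exists c, forall f, A f = c *: f.
Proof.
move=> L0' L0n L1' A' AL1; pose a j := (A 'X^j)`_0.
have a0 r : a r.+1 = 0.
  (* With L_0 f = t^r, the constant term of sum_j a_(j+1) D^j/j! (L_0 f) is exactly a_(r+1). *)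
  have [f L0f] := comm_deriv_surj L0' L0n 'X^r.
  pose n := maxn (maxn (size f) (size (L1 f))) r.+1.
  have lef : (size f <= n.+1)%N by rewrite leqW // !leq_max leqnn.
  have leL : (size (L1 f) <= n.+1)%N by rewrite leqW // !leq_max leqnn orbT.
  have ler : (r < n)%N by rewrite !leq_max leqnn orbT.
  have := AL1 f; rewrite (comm_derivE A' lef) (comm_derivE A' leL) linear_sum.
  rewrite !big_ord_recl linearZ !nderivn0 /= => /addrI/esym.
  under eq_bigr do rewrite linearZ /= (nderivn_ladder _ _ L1' L0') scalerDr.
  rewrite big_split /= -[X in _ = X]addr0 => /addrI.
  move/(congr1 (fun p : {poly K} => p`_0)); rewrite coef_sum coef0.
  under eq_bigr do rewrite L0f coefZ coef0_nderivn coefXn.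
  rewrite (bigD1 (Ordinal ler)) //= eqxx mulr1 big1 ?addr0 // => i.
  by rewrite -val_eqE /= => /negPf ->; rewrite mulr0.
exists (a 0%N) => f; rewrite (comm_derivE A' (leqnSn (size f))) big_ord_recl.
rewrite nderivn0 big1 ?addr0 // => i _.
by rewrite /= -/(a i.+1) a0 scale0r.
Qed.

End Commutant.

(** * Coefficient operators and their Casimir identities *)

Section VirasoroOperators.
Variable K : numFieldType.

(** These are the axioms read coefficientwise; by skew symmetry the two bracket rules cover all
    pairs of indices. *)
Record vir_ops (L : nat -> {linear {poly K} -> {poly K}}) : Prop := VirOps {
  vir_der0 : comm_deriv (L 0%N);
  vir_derS : forall n f, L n.+1 f^`() = (L n.+1 f)^`() + L n f;
  vir_bracket0 : forall n f, L 0%N (L n.+1 f) - L n.+1 (L 0%N f) = - L n f;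
  vir_bracketS : forall m n f, L m.+1 (L n.+1 f) - L n.+1 (L m.+1 f) =
    ('C((m + n).+1, m)%:R - 'C((m + n).+1, m.+1)%:R) *: L (m + n).+1 f }.

Variable L : nat -> {linear {poly K} -> {poly K}}.
Hypothesis L_vir : vir_ops L.
Implicit Types f g : {poly K}.

(** Since [L_0, L_(n+1)] = - L_n, a nontrivial action has L_0 nonzero. *)
Lemma vir_zero : (forall f, L 0%N f = 0) -> forall n f, L n f = 0.
Proof.
move=> L0 n f; have /esym/eqP := vir_bracket0 L_vir n f.
by rewrite !L0 linear0 subr0 oppr_eq0 => /eqP.
Qed.

Hypothesis L0_neq0 : exists f, L 0%N f <> 0.

Let d0 := vir_der0 L_vir.
Let d1 := vir_derS L_vir 0.
Let d2 := vir_derS L_vir 1.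
Let d3 := vir_derS L_vir 2.

Let swap0 n f : L n.+1 (L 0%N f) = L 0%N (L n.+1 f) + L n f.
Proof.
by have /eqP := vir_bracket0 L_vir n f; rewrite subr_eq => /eqP ->; ring.
Qed.

Let swap1 n f : L n.+1 (L 1%N f) = L 1%N (L n.+1 f) + n%:R *: L n.+1 f.
Proof.
have /eqP := vir_bracketS L_vir 0 n f; rewrite subr_eq => /eqP ->.
by rewrite bin0 bin1 add0n -!mul_polyC polyCB !polyC_natr -natr1; ring.
Qed.

Let swap12 f : L 2 (L 1 f) = L 1 (L 2 f) + L 2 f.
Proof. by rewrite swap1 scale1r. Qed.

Let swap13 f : L 3 (L 1 f) = L 1 (L 3 f) + L 3 f *+ 2.
Proof. by rewrite swap1 scaler_nat. Qed.

Let LD n f g : L n (f + g) = L n f + L n g. Proof. exact: linearD. Qed.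
Let LMn n f m : L n (f *+ m) = L n f *+ m. Proof. exact: linearMn. Qed.
Let LN n f : L n (- f) = - L n f. Proof. exact: linearN. Qed.
Let LZ n c f : L n (c *: f) = c *: L n f. Proof. exact: linearZ. Qed.

Let norm := (d0, d1, d2, d3, swap0, swap12, swap13, LD, LMn, LN, LZ, derivD,
  derivN, derivMn, derivZ, scalerDr).

(** L_0 and D have the same bracket with L_1, namely - L_0, so L_0 - D commutes with L_1. *)
Lemma vir_L0E : exists b, forall f, L 0%N f = f^`() + b *: f.
Proof.
have [|f|b bE] := comm_scalar (A := L 0%N \- @deriv K) d0 L0_neq0 d1.
- by move=> f /=; rewrite d0 derivB.
- by rewrite /= linearB /= d1 swap0; ring.
by exists b => f; rewrite -bE /=; ring.
Qed.

(** L_0, L_1, L_2 satisfy the sl_2 relations up to scaling, and c is the value of the Casimir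
    element. *)
Lemma vir_casimir2 : exists c, forall f,
  L 2 (L 0 f) *+ 2 = L 1 (L 1 f) + L 1 f + c *: f.
Proof.
have [||c cE] := comm_scalar
  (A := (2%:R \*: (L 2 \o L 0%N)) \- (L 1 \o L 1) \- L 1) d0 L0_neq0 d1.
- by move=> f; rewrite /= !scaler_nat !norm; ring.
- by move=> f; rewrite /= !scaler_nat !norm; ring.
by exists c => f; rewrite -cE /= scaler_nat; ring.
Qed.

Lemma vir_casimir3 c :
    (forall f, L 2 (L 0 f) *+ 2 = L 1 (L 1 f) + L 1 f + c *: f) ->
  exists d, forall f, L 3 (L 0 (L 0 f)) *+ 6 =
    L 1 (L 1 (L 1 f)) + L 1 (L 1 f) *+ 3 + L 1 f *+ 2
    + (c *: L 1 f) *+ 3 + d *: f.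
Proof.
move=> cE.
have [||d dE] := comm_scalar
  (A := (6%:R \*: (L 3 \o L 0%N \o L 0%N)) \- (L 1 \o L 1 \o L 1)
     \- (3%:R \*: (L 1 \o L 1)) \- (2%:R \*: L 1)
     \- (c \*: L 1) \- (c \*: L 1) \- (c \*: L 1)) d0 L0_neq0 d1.
- move=> f; rewrite /= !scaler_nat !norm.
  (* The quadratic identity at L_0 f trades c for operators, after which the commutation rules
     suffice. *)
  have -> : c *: L 0%N f =
      L 2 (L 0 (L 0 f)) *+ 2 - (L 1 (L 1 (L 0 f)) + L 1 (L 0 f)).
    by rewrite cE; ring.
  by rewrite !norm; ring.
- by move=> f; rewrite /= !scaler_nat !norm; ring.
by exists d => f; rewrite -dE /= !scaler_nat; ring.
Qed.

End VirasoroOperators.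

(** * Symbols of operators *)

Section Symbols.
Variables (K : comNzRingType) (V : lmodType K) (Y E : {linear V -> V}).
Hypothesis YE : forall v, E (Y v) = Y (E v + v).
Implicit Types (A B : V -> V) (p q : {poly K}).

(* That is, A Y^k = p(E); in the application Y = L_0 is onto, E = L_1, and
   L_n L_0^(n-1) is a polynomial in L_1. *)
Definition symbol A k p := forall v, A (iter k Y v) = opev E v p.

Let shift1 v q : opev E (Y v) q = Y (opev E v (q \Po ('X + 1))).
Proof.
elim/poly_ind: q => [|q c IHq]; first by rewrite comp_poly0 !linear0.
rewrite comp_polyD comp_polyM comp_polyX comp_polyC mulrDr mulr1.
by rewrite !linearD /= !opevMX !opevC IHq YE linearD linearZ.
Qed.

(** As E Y = Y (E + 1), each passage of Y shifts the argument of q by one. *)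
Lemma opev_shift k v q :
  opev E (iter k Y v) q = iter k Y (opev E v (q \Po ('X + k%:R))).
Proof.
elim: k q => [|k IHk] q; first by rewrite addr0 comp_polyXr.
rewrite iterS shift1 IHk -comp_polyA iterS.
by rewrite comp_polyD comp_polyX rmorph1 -addrA natr1.
Qed.

Definition commutator A B : V -> V := fun v => A (B v) - B (A v).

(** A B Y^(k+l) = A q(E) Y^k = A Y^k q(E + k) = p(E) q(E + k), and likewise for B A. *)
Lemma symbol_commutator A B k l p q : symbol A k p -> symbol B l q ->
  symbol (commutator A B) (k + l)
    (p * (q \Po ('X + k%:R)) - q * (p \Po ('X + l%:R))).
Proof.
have AB C D m n r s w : symbol C m r -> symbol D n s ->
    C (D (iter n Y (iter m Y w))) = opev E w (r * (s \Po ('X + m%:R))).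
  by move=> Cr Ds; rewrite Ds opev_shift Cr opevM.
move=> Ap Bq v; rewrite linearB /= /commutator {1}addnC !iterD.
by rewrite (AB _ _ _ _ _ _ _ Ap Bq) (AB _ _ _ _ _ _ _ Bq Ap).
Qed.

End Symbols.

(** * The cubic relation between the Casimir scalars *)

Section CasimirRelation.
Variables (K : numFieldType) (L : nat -> {linear {poly K} -> {poly K}}).
Hypothesis L_vir : vir_ops L.
Variables c d : K.
Hypothesis casimir2 : forall f,
  L 2 (L 0 f) *+ 2 = L 1 (L 1 f) + L 1 f + c *: f.
Hypothesis casimir3 : forall f, L 3 (L 0 (L 0 f)) *+ 6 =
  L 1 (L 1 (L 1 f)) + L 1 (L 1 f) *+ 3 + L 1 f *+ 2
    + (c *: L 1 f) *+ 3 + d *: f.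

Lemma commutator_scale m n a b f :
  commutator (a \*: L m.+1) (b \*: L n.+1) f =
  (a * b * ('C((m + n).+1, m)%:R - 'C((m + n).+1, m.+1)%:R)) *: L (m + n).+1 f.
Proof.
rewrite -scalerA -(vir_bracketS L_vir) /commutator /= !linearZ /= !scalerA.
by rewrite scalerBr [b * a]mulrC scalerN.
Qed.

Let A2 := 2%:R \*: L 2.
Let A3 := 6%:R \*: L 3.
Let A4 := commutator A2 A3.

(* Both [L2, L5] and [L3, L4] are multiples of L6, where L4 and L5 are
   themselves multiples of [L2, L3] and [L2, [L2, L3]]. *)
Lemma commutator_relation f :
  commutator A2 (commutator A2 A4) f + commutator A3 A4 f *+ 6 = 0.
Proof.
have A4E : A4 = (- 24%:R) \*: L 4.
  apply/funext => g; rewrite /A4 commutator_scale; congr (_ *: _).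
  by rewrite (_ : 'C(_, 1) = 4)%N // (_ : 'C(_, 2) = 6)%N //; ring.
have A5E : commutator A2 A4 = 240%:R \*: L 5.
  apply/funext => g; rewrite A4E commutator_scale; congr (_ *: _).
  by rewrite (_ : 'C(_, 1) = 5)%N // (_ : 'C(_, 2) = 10)%N //; ring.
(* The coefficients of L_6 are 2 * 240 * (6 - 15) = - 4320 and 6 * (- 24) * (15 - 20) = 720, whence
   the factor 6. *)
rewrite A5E A4E !commutator_scale -scaler_nat scalerA -scalerDl.
rewrite (_ : 'C(_, 1) = 6)%N // (_ : 'C(_, 2) = 15)%N //.
rewrite (_ : 'C(_, 3) = 20)%N //.
by rewrite -[RHS](scale0r (L 6 f)); congr (_ *: _); ring.
Qed.

(** Both terms of [commutator_relation] have symbols of order 5. In their combination all positive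
    powers of L_1 cancel, leaving a constant that must annihilate 1. *)
Lemma casimir_relation : d ^+ 2 - c * d *+ 6 + c ^+ 2 *+ 8 + c ^+ 3 *+ 4 = 0.
Proof.
have YE v : L 1 (L 0 v) = L 0 (L 1 v + v).
  rewrite linearD /=; have /eqP := vir_bracket0 L_vir 0 v.
  by rewrite subr_eq => /eqP ->; ring.
pose q2 : {poly K} := 'X * 'X + 'X + c%:P.
pose q3 : {poly K} := 
    'X * 'X * 'X + ('X * 'X) *+ 3 + 'X *+ 2 + (c *: 'X) *+ 3 + d%:P.
have S2 : symbol (L 0) (L 1) A2 1 q2.
  move=> v; rewrite /A2 /= scaler_nat casimir2 !linearD /=.
  by rewrite opevMX opevX opevC.
have S3 : symbol (L 0) (L 1) A3 2 q3.
  move=> v; rewrite /A3 /= scaler_nat casimir3.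
  have opD p q : opev (L 1) v (p + q) = opev (L 1) v p + opev (L 1) v q.
    exact: linearD.
  have opMn p n : opev (L 1) v (p *+ n) = opev (L 1) v p *+ n.
    exact: linearMn.
  have opZ p a : opev (L 1) v (a *: p) = a *: opev (L 1) v p by exact: linearZ.
  by rewrite !(opMn, opD, opZ) !opevMX opevX opevC.
have S4 := symbol_commutator YE S2 S3.
have S6 := symbol_commutator YE S2 (symbol_commutator YE S2 S4).
have S6' := symbol_commutator YE S3 S4.
have := commutator_relation (iter 5 (L 0) 1).
have -> : commutator A3 A4 (iter 5 (L 0) 1) = _ := S6' 1.
rewrite [X in X + _](S6 1) -linearMn -linearD /=.
set q := _ + _ *+ _; have -> : q =
    ((d ^+ 2 - c * d *+ 6 + c ^+ 2 *+ 8 + c ^+ 3 *+ 4) * - 48%:R)%:P.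
  rewrite /q /q3 /q2 -mul_polyC.
  have compMn (p r : {poly K}) n : (p *+ n) \Po r = (p \Po r) *+ n.
    exact: raddfMn.
  have compN (p r : {poly K}) : (- p) \Po r = - (p \Po r) by exact: raddfN.
  have comp1 (r : {poly K}) : 1 \Po r = 1 by exact: rmorph1.
  rewrite !(compMn, compN, comp1, comp_polyD, comp_polyM, comp_polyX,
    comp_polyC).
  by ring.
rewrite opevC => /eqP; rewrite scaler_eq0 oner_eq0 orbF mulf_eq0 oppr_eq0.
by rewrite pnatr_eq0 orbF => /eqP.
Qed.

End CasimirRelation.

(** * Coefficients of the module axioms *)

Section Coefficients.
Variables (K : numFieldType) (V : gcmod K).
Implicit Types v : V.

Lemma gc_act_der0 v : gc_act V (gc_der V v) 0%N = gc_der V (gc_act V v 0%N).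
Proof.
by rewrite -[RHS]addr0; exact: (congr1 (@^~ 0%N) (gc_act_der v)).
Qed.

Lemma gc_act_derS n v :
  gc_act V (gc_der V v) n.+1 = gc_der V (gc_act V v n.+1) + gc_act V v n.
Proof. exact: (congr1 (@^~ n.+1) (gc_act_der v)). Qed.

Lemma gc_bracket0 n v :
  gc_act V (gc_act V v n.+1) 0%N - gc_act V (gc_act V v 0%N) n.+1 =
  - gc_act V v n.
Proof.
have := congr1 (fun F => F 0%N n.+1) (gc_jacobi v).
rewrite -[X in X = _]/(gc_act V (gc_act V v n.+1) 0%N -
  gc_act V (gc_act V v 0%N) n.+1) => ->.
rewrite -[LHS]/(0 - gc_act V v (0 + n)%N *+ 'C(0 + n, 0)).
by rewrite bin0 sub0r.
Qed.

(** The scalar is the coefficient of lambda^(m+1) mu^(n+1) in (lambda - mu)(lambda + mu)^(m+n+1). *)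
Lemma gc_bracketS m n v :
  gc_act V (gc_act V v n.+1) m.+1 - gc_act V (gc_act V v m.+1) n.+1 =
  ('C((m + n).+1, m)%:R - 'C((m + n).+1, m.+1)%:R) *: gc_act V v (m + n).+1.
Proof.
have := congr1 (fun F => F m.+1 n.+1) (gc_jacobi v).
rewrite -[X in X = _]/(gc_act V (gc_act V v n.+1) m.+1 -
  gc_act V (gc_act V v m.+1) n.+1) => ->.
rewrite -[LHS]/(gc_act V v (m + n.+1)%N *+ 'C(m + n.+1, m) -
  gc_act V v (m.+1 + n)%N *+ 'C(m.+1 + n, m.+1)).
by rewrite addnS addSn -!scaler_nat -scalerBl.
Qed.

End Coefficients.

(** * Classification of the operators on K[t] *)

Section Classification.
Variables (K : numFieldType) (L : nat -> {linear {poly K} -> {poly K}}).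
Hypothesis L_vir : vir_ops L.
Hypothesis L0_neq0 : exists f, L 0%N f <> 0.
Implicit Types f g : {poly K}.

(** The condition on the kernel of L_0 makes - (L_1 + a) L_0^-1 well defined; the same a has to
    parametrize both Casimir scalars. *)
Lemma vir_parameters b : (forall f, L 0%N f = f^`() + b *: f) ->
  exists a, [/\ forall f, L 0%N f = 0 -> L 1%N f = - (a *: f),
    forall f, L 2 (L 0 f) *+ 2 = L 1 (L 1 f) + L 1 f + (a * (1 - a)) *: f
  & forall f, L 3 (L 0 (L 0 f)) *+ 6 =
      L 1 (L 1 (L 1 f)) + L 1 (L 1 f) *+ 3 + L 1 f *+ 2
      + ((a * (1 - a)) *: L 1 f) *+ 3 + (2%:R * a * (1 + a) * (1 - a)) *: f].
Proof.
move=> L0E.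
have [c c2] := vir_casimir2 L_vir L0_neq0.
have [d d3] := vir_casimir3 L_vir L0_neq0 c2.
have rel := casimir_relation L_vir c2 d3.
suff [a [ker_a ca da]] : exists a, [/\
    forall f, L 0%N f = 0 -> L 1%N f = - (a *: f),
    c = a * (1 - a) & d = 2%:R * a * (1 + a) * (1 - a)].
  by exists a; split => // f; rewrite ?c2 ?d3 ca ?da.
(* If b = 0 the curve is not needed: a is read off L_1 1 = - a, and evaluating
   both Casimir identities at 1, where L_0 vanishes, gives c and d. *)
have [b0|b0] := eqVneq b 0.
  have L01 : L 0%N 1 = 0 by rewrite L0E b0 scale0r addr0 derivC.
  pose a := - (L 1%N 1)`_0.
  have L11 : L 1%N 1 = - a%:P.
    rewrite -polyCN opprK; apply: deriv_eq0.
    have := vir_derS L_vir 0 1; rewrite derivC linear0 L01 addr0.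
    by move/esym.
  have L1C e : L 1%N e%:P = - (a * e)%:P.
    by rewrite -[e%:P]mulr1 mul_polyC linearZ /= L11 -mul_polyC polyCM; ring.
  have ca : c = a * (1 - a).
    have := c2 1; rewrite L01 linear0 mul0rn L11 linearN /= L1C opprK.
    rewrite -mul_polyC mulr1 => /esym /(congr1 (fun p : {poly K} => p`_0)).
    rewrite !coefE /= => h.
    by apply/eqP; rewrite -subr_eq0 -h; apply/eqP; ring.
  exists a; split => // [f|].
    rewrite L0E b0 scale0r addr0 => /deriv_eq0 ->.
    by rewrite L1C polyCM mul_polyC.
  have := d3 1; rewrite L01 !linear0 mul0rn L11.
  rewrite !linearN /= !L1C !linearN /= !L1C.
  rewrite -!mul_polyC mulr1 => /esym /(congr1 (fun p : {poly K} => p`_0)).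
  rewrite !coefE /= ca => h.
  by apply/eqP; rewrite -subr_eq0 -h; apply/eqP; ring.
(* For b <> 0, L_0 1 = b makes L_0 injective, so every a meets the kernel condition and a is
   dictated by c and d alone. *)
have ker0 f : L 0%N f = 0 -> f = 0.
  have L01 : L 0%N 1 <> 0.
    rewrite L0E derivC add0r => /eqP.
    by rewrite scaler_eq0 oner_eq0 orbF (negPf b0).
  move=> L0f; apply: (comm_deriv_inj (vir_der0 L_vir) L01).
  by rewrite L0f linear0.
have ker a f : L 0%N f = 0 -> L 1%N f = - (a *: f).
  by move/ker0 ->; rewrite linear0 scaler0 oppr0.
(* At c = 0 the curve reduces to d^2 = 0. *)
have [c0|c0] := eqVneq c 0.
  exists 0; split=> [f||]; [exact: ker | by rewrite c0 mul0r |].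
  have := rel; rewrite c0 mul0r !expr0n /= !mul0rn subr0 !addr0 => /eqP.
  by rewrite expf_eq0 /= => /eqP ->; rewrite mulr0 !mul0r.
have n2 : 2%:R != 0 :> K by rewrite pnatr_eq0.
(* The parametrization is inverted by d / c = 2 (1 + a); the errors in c and d are then multiples of
   the cubic. *)
exists (d / (2%:R * c) - 1); split => [f||]; first exact: ker.
  apply/eqP; rewrite -subr_eq0; apply/eqP.
  rewrite -[RHS](mul0r (4%:R * c ^+ 2)^-1) -rel; field; by rewrite ?c0 ?n2.
apply/eqP; rewrite -subr_eq0; apply/eqP.
rewrite -[RHS](mul0r (d / (4%:R * c ^+ 3))) -rel; field; by rewrite ?c0 ?n2.
Qed.

(** D L_1 = L_1 D - L_0 gives D T = T D + 1 on the image of L_0, which is everything. In U_(a,b), T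
    is multiplication by t. *)
Lemma vir_gauge a b : (forall f, L 0%N f = f^`() + b *: f) ->
    (forall f, L 0%N f = 0 -> L 1%N f = - (a *: f)) ->
  exists T : {linear {poly K} -> {poly K}},
    (forall f, T (L 0%N f) = - (L 1%N f + a *: f)) /\
    (forall f, T f^`() + f = (T f)^`()).
Proof.
move=> L0E ker_a.
have [s sE] := choice (comm_deriv_surj (vir_der0 L_vir) L0_neq0).
(* T does not depend on the choice of the section s, as L_1 + a vanishes on
   the kernel of L_0. *)
pose T f := - (L 1%N (s f) + a *: s f).
have TL f : T (L 0%N f) = - (L 1%N f + a *: f).
  have := ker_a (s (L 0%N f) - f).
  rewrite linearB /= sE subrr => /(_ erefl); rewrite linearB /= => /eqP.
  rewrite subr_eq /T => /eqP ->.
  by rewrite -!mul_polyC; ring.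
have T_linear : linear T.
  move=> c f g; rewrite -[f in LHS]sE -[g in LHS]sE -linearP TL linearP.
  by rewrite /T -!mul_polyC /=; ring.
pose T' : {linear {poly K} -> {poly K}} :=
  HB.pack T (GRing.isLinear.Build K {poly K} {poly K} _ T T_linear).
exists T'; split=> // f.
rewrite -[f]sE -(vir_der0 L_vir) /= !TL (vir_derS L_vir) derivN derivD derivZ.
by rewrite -!mul_polyC; ring.
Qed.

Lemma vir_classification :
  exists (a b : K) (phi : {linear {poly K} -> {poly K}}),
  [/\ bijective phi, comm_deriv phi
    & forall n f, L n (phi f) = phi (U_act a b f n)].
Proof.
have [b L0E] := vir_L0E L_vir L0_neq0.
have [a [ker_a c2 c3]] := vir_parameters L0E.
have [T [TL T']] := vir_gauge L0E ker_a.
pose phi : {linear {poly K} -> {poly K}} := opev T 1.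
have phiX f : phi (f * 'X) = T (phi f) by exact: opevMX.
have phi1 : phi 1 = 1 by rewrite -polyC1 /phi /= opevC scale1r.
(* [phi] turns multiplication by t into T, and [D, T] = 1 matches the product rule. *)
have phi' : comm_deriv phi.
  elim/poly_ind => [|f c IHf]; first by rewrite !(linear0, deriv0).
  rewrite derivD derivC addr0 derivM derivX mulr1 !linearD /= !phiX -T' -IHf.
  rewrite -[c%:P]mulr1 mul_polyC [phi (_ *: _)]linearZ /= phi1.
  by rewrite derivZ derivC scaler0 addr0.
have e0 : expNt K 0 = 1 by rewrite /expNt expr0 fact0 divr1 scale1r.
have e1 : expNt K 1 = - 'X by rewrite /expNt !expr1 factS fact0 divr1 scaleN1r.
have e2 : expNt K 2 *+ 2 = 'X^2.
  rewrite /expNt sqrrN expr1n scalerMnl div1r -mulr_natr.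
  by rewrite mulVf ?scale1r ?pnatr_eq0.
have e3 : expNt K 3 *+ 6 = - 'X^3.
  rewrite /expNt -signr_odd /= expr1 scalerMnl -mulr_natr.
  by rewrite divfK ?scaleN1r ?pnatr_eq0.
have u0 f : U_act a b f 0 = f^`() + b *: f.
  by rewrite U_actE e0 mul1r mul0r scaler0 subr0.
have u1 f : U_act a b f 1 = - (U_act a b f 0 * 'X + a *: f).
  by rewrite u0 U_actE /= e0 e1 -!mul_polyC; ring.
have u2 f : U_act a b f 2 *+ 2 = 'X^2 * U_act a b f 0 + (a *: ('X * f)) *+ 2.
  by rewrite u0 U_actE /= e1 -e2 -!mul_polyC; ring.
have u3 f : U_act a b f 3 *+ 6 =
    - ('X^3 * U_act a b f 0) - (a *: ('X^2 * f)) *+ 3.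
  by rewrite u0 U_actE /= -mulNr -e3 -e2 -!mul_polyC; ring.
have L0u f : L 0%N (phi f) = phi (U_act a b f 0).
  by rewrite u0 linearD linearZ /= L0E phi'.
have L1u f : L 1%N (phi f) = phi (U_act a b f 1).
  by rewrite u1 linearN linearD linearZ /= phiX -L0u TL; ring.
have phi_inj : injective phi.
  by apply: comm_deriv_inj => //; rewrite phi1; apply/eqP/oner_neq0.
have phi_surj g : exists f, phi f = g.
  by apply: comm_deriv_surj => //; exists 1; rewrite phi1; apply/eqP/oner_neq0.
(* The Casimir identities determine L_2 only on the image of L_0, and L_3 only on that of L_0^2;
   every f is therefore written as such an image in U_(a,b). *)
have u_surj g : exists f, U_act a b f 0 = g.
  have [h hE] := comm_deriv_surj (vir_der0 L_vir) L0_neq0 (phi g).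
  have [f fE] := phi_surj h.
  by exists f; apply: phi_inj; rewrite -L0u fE hE.
have d1 : (1 : {poly K})^`() = 0 by rewrite -polyC1 derivC.
have L2u f : L 2 (phi f) = phi (U_act a b f 2).
  have [g <-] := u_surj f; apply: (@mulrn_fact_inj _ 2).
  rewrite -L0u [LHS]c2 !L1u -linearZ -!linearD -linearMn; congr (phi _).
  rewrite -[RHS]/(U_act a b _ 2 *+ 2).
  rewrite u2 !u1 !u0 !(derivN, derivD, derivM, derivX, derivZ) -!mul_polyC.
  by ring.
have L3u f : L 3 (phi f) = phi (U_act a b f 3).
  have [g <-] := u_surj f; have [h <-] := u_surj g.
  apply: (@mulrn_fact_inj _ 3).
  have phiMn q n : phi (q *+ n) = phi q *+ n by exact: linearMn.
  have phiZ c q : phi (c *: q) = c *: phi q by exact: linearZ.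
  rewrite -!L0u [LHS]c3 !L1u -!phiZ -!phiMn -!linearD; congr (phi _).
  rewrite -[RHS]/(U_act a b _ 3 *+ 6).
  rewrite u3 !u1 !u0 !(d1, derivN, derivD, derivM, derivX, derivZ) -!mul_polyC.
  by ring.
exists a, b, phi; split=> //.
  have [s sE] := choice phi_surj.
  by exists s => // f; apply: phi_inj; rewrite sE.
elim=> [//|[//|[//|[//|n]]]] IHn f.
(* Here k = - (n + 1)(n + 4) / 2, so [L_2, L_(n+3)] determines L_(n+4). *)
pose k : K := 'C((1 + n.+2).+1, 1)%:R - 'C((1 + n.+2).+1, 2)%:R.
have k0 : k != 0.
  rewrite subr_eq0 eqr_nat neq_ltn; apply/orP; left.
  rewrite -[(1 + n.+2).+1]/n.+4 bin1 binS bin1 binS bin1 -addnA.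
  by apply: leq_trans (leq_addl _ _); rewrite !addSn !addnS !ltnS leq_addr.
have u_bracket g :
  U_act a b (U_act a b g n.+3) 2 - U_act a b (U_act a b g 2) n.+3 =
  k *: U_act a b g n.+4 := gc_bracketS (V := U a b) 1 n.+2 g.
apply: (scalerI k0); rewrite -(vir_bracketS L_vir) -linearZ -u_bracket linearB.
by rewrite !IHn !L2u IHn.
Qed.

End Classification.

(** * Transport to modules of corank one *)

Section CorankOne.
Variables (K : numFieldType) (V : gcmod K).

Lemma linear_poly_ext (W : lmodType K) (A B : {linear {poly K} -> W}) :
  (forall n, A 'X^n = B 'X^n) -> A =1 B.
Proof.
move=> AB f; rewrite -[f]coefK poly_def !linear_sum.
by apply: eq_bigr => i _; rewrite !linearZ /= AB.
Qed.

(* v_i corresponds to t^i / i!. *)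
Lemma corank_one_poly : corank_one V ->
  exists psi : {linear {poly K} -> V},
    bijective psi /\ forall f, psi f^`() = gc_der V (psi f).
Proof.
case=> v [[v_span v_free] v_der].
have fn0 i : i`!%:R != 0 :> K by rewrite pnatr_eq0 -lt0n fact_gt0.
pose psi : {linear {poly K} -> V} := lincomb (fun i => i`!%:R *: v i).
have psi_inj : injective psi.
  move=> f g /eqP; rewrite -subr_eq0 -linearB => /eqP psi0.
  apply/eqP; rewrite -subr_eq0; apply/eqP/polyP => i; rewrite coef0.
  have [lt_i|] := ltnP i (size (f - g)); last exact: nth_default.
  apply: (mulIf (fn0 i)); rewrite mul0r.
  apply: (v_free _ (fun i => (f - g)`_i * i`!%:R) _ i lt_i).
  by rewrite -[RHS]psi0; apply: eq_bigr => j _; rewrite scalerA.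
have psi_surj x : exists f, psi f = x.
  have [n [c ->]] := v_span x; exists (\poly_(i < n) (c i / i`!%:R)).
  rewrite /= (lincombE _ (size_poly _ _)); apply: eq_bigr => i _.
  by rewrite coef_poly ltn_ord scalerA divfK.
exists psi; split.
  have [s sE] := choice psi_surj.
  by exists s => // f; apply: psi_inj; rewrite sE.
apply: (@linear_poly_ext _ (psi \o @deriv K) (gc_der V \o psi)) => n /=.
rewrite derivXn -scaler_nat [LHS]linearZ /= !lincombXn.
rewrite [gc_der V _]linearZ /= v_der.
case: n => [|n]; first by rewrite scale0r scaler0.
by rewrite scalerA factS natrM.
Qed.

(** Conjugating the coefficients of the action by [psi] yields operators on K[t] to which
    [vir_classification] applies; the isomorphism is the inverse of [psi \o phi]. *)
Lemma corank_one_classification : corank_one V -> gc_nontrivial V ->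
  exists a b : K, gc_isom V (U a b).
Proof.
move=> /corank_one_poly [psi [[s sK psiK] psi']] [v0 v0n].
have actP n c (u v : V) :
    gc_act V (c *: u + v) n = c *: gc_act V u n + gc_act V v n.
  by rewrite linearP.
have actB n (u v : V) : gc_act V (u - v) n = gc_act V u n - gc_act V v n.
  by rewrite linearB.
have sP : linear s.
  by move=> c u v; apply: (can_inj sK); rewrite linearP !psiK.
pose ell n f := s (gc_act V (psi f) n).
have ell_linear n : linear (ell n).
  by move=> c f g; rewrite /ell linearP actP sP.
pose L n : {linear {poly K} -> {poly K}} :=
  HB.pack (ell n)
    (GRing.isLinear.Build K {poly K} {poly K} _ (ell n) (ell_linear n)).
have psiL n f : psi (L n f) = gc_act V (psi f) n by rewrite /= /ell psiK.
have L_vir : vir_ops L.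
  split=> [f|n f|n f|m n f]; apply: (can_inj sK).
  - by rewrite psi' !psiL psi' gc_act_der0.
  - by rewrite linearD psi' !psiL psi' gc_act_derS.
  - by rewrite linearB linearN !psiL gc_bracket0.
  - by rewrite linearB linearZ !psiL gc_bracketS.
have L0n : exists f, L 0%N f <> 0.
  apply: contrapT => L0; apply: v0n; apply/funext => n.
  rewrite -(psiK v0) -psiL (vir_zero L_vir) ?linear0 // => f.
  by apply: contrapT => L0f; apply: L0; exists f.
have [a [b [phi [[r phiK rK] phi' phiL]]]] := vir_classification L_vir L0n.
have rP : linear r.
  by move=> c f g; apply: (can_inj phiK); rewrite linearP !rK.
exists a, b.
have hP : linear (fun v : V => r (s v) : U a b).
  by move=> c u v; rewrite sP rP.
pose h : {linear V -> U a b} := HB.pack (fun v : V => r (s v) : U a b)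
  (GRing.isLinear.Build K V (U a b) _ _ hP).
exists h; split=> [|v|v n].
- by exists (psi \o phi) => v /=; rewrite ?rK ?psiK // sK phiK.
- by apply: (can_inj phiK); apply: (can_inj sK); rewrite /= phi' !rK psi' !psiK.
- apply: (can_inj phiK); rewrite /= rK -[RHS]phiL rK.
  by apply: (can_inj sK); rewrite psiL !psiK.
Qed.

End CorankOne.

(** * Irreducibility of U_(a,b) *)

Section Irreducibility.
Variables (K : numFieldType) (a b : K).

Lemma U_irreducible : gc_irreducible (U a b) <-> (a, b) <> (0, 0).
Proof.
split=> [[_ irr] [a0 b0]|ab0].
  (* On U_(0,0), L_lambda f = e^(- lambda t) f', so the constants form a proper nonzero
     submodule. *)
  pose S : set (U a b) := [set f : {poly K} | f^`() = 0]%classic.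
  have U0 f n : S f -> U_act a b f n = 0.
    rewrite /S /= => f'; rewrite U_actE a0 b0 f' !scale0r.
    by rewrite addr0 mulr0 subr0.
  have S_sub : gc_submodule S.
    split; rewrite /S /=.
    - exact: deriv0.
    - by move=> f g f' g'; rewrite derivD f' g' addr0.
    - by move=> c f f'; rewrite derivZ f' scaler0.
    - by move=> f f'; rewrite f' deriv0.
    - by move=> f n Sf; rewrite (U0 f n Sf) deriv0.
  have n0 : (1 : {poly K}) <> 0 by apply/eqP/oner_neq0.
  case: (irr S S_sub) => SE; apply: n0.
    have : S (1 : {poly K}) by rewrite /S /= -polyC1 derivC.
    by rewrite SE.
  have : S ('X : {poly K}) by rewrite SE.
  by rewrite /S /= derivX.
split; first by exists (1 : {poly K}); apply/eqP/oner_neq0.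
move=> S [S0 SD SZ S' SU].
have [SE|] := pselect (S = [set 0]%classic); [by left | move=> Sn0; right].
have [f Sf f0] : exists2 f : {poly K}, S f & f <> 0.
  apply: contrapT => nS; apply: Sn0; apply/seteqP; split=> [f Sf|_ ->] //.
  by apply: contrapT => f0; apply: nS; exists f.
have [c c0 Sc] := deriv_closed_const S' Sf f0.
have S1 : S (1 : {poly K}).
  have -> : 1 = c^-1 *: c%:P by rewrite -mul_polyC -polyCM mulVf.
  exact: SZ.
(* These are the coefficients of L_lambda 1 = (b - a lambda) e^(- lambda t). *)
have U1 n : S (b *: expNt K n - a *: mulvar (expNt K) n : {poly K}).
  have := SU 1 n S1; rewrite -[gc_act _ _ _]/(U_act a b 1 n) U_actE derivC.
  by rewrite add0r mulr1 -scalerAr mulr1.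
(* The factor b - a lambda is divided out: a shift of coefficients if b = 0, a recursion on n
   otherwise. *)
have Se n : S (expNt K n).
  have [b0|b0] := eqVneq b 0.
    have a0 : a != 0 by apply/eqP => a0; apply: ab0; rewrite a0 b0.
    have := U1 n.+1; rewrite b0 scale0r sub0r -scaleNr => /(SZ (- a)^-1).
    by rewrite scalerK ?oppr_eq0.
  elim: n => [|n IHn].
    have := U1 0%N; rewrite scaler0 subr0 => /(SZ b^-1).
    by rewrite scalerK.
  have /(SD _ _ (SZ a _ IHn)) /(SZ b^-1) := U1 n.+1.
  by rewrite addrC subrK scalerK.
have SX n : S ('X^n : {poly K}).
  have u0 : (-1) ^+ n / n`!%:R != 0 :> K.
    by rewrite mulf_neq0 ?signr_eq0 // invr_eq0 pnatr_eq0 -lt0n fact_gt0.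
  by rewrite -['X^n](scalerK u0); apply: SZ (Se n).
apply/seteqP; split=> // g _.
rewrite -[g : {poly K}]coefK poly_def.
by elim/big_ind: _ => [||i _] //; apply: SZ.
Qed.

End Irreducibility.

Theorem theorem5p5 (R : realType) :
  (forall V : gcmod (complex R), corank_one V -> gc_nontrivial V ->
     exists a b : complex R, gc_isom V (U a b)) /\
  (forall a b : complex R, gc_irreducible (U a b) <-> (a, b) <> (0, 0)).
Proof.
split=> [V|a b]; first exact: corank_one_classification.
exact: U_irreducible.
Qed.
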